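(* For $n\ge1$ and $m\ge0$, the dimensions of the homogeneous components of $B_{2,2}$ are given by: (i) $\mathsf b_{2,2}(n,m)=\#\mathcal{RP}(n,m)=C(m)\binom{m+1}{n-m}$; (ii) $\mathsf b_{2,2}(n,* )=2\cdot\#\mathcal{MP}_{hu}(n)$; (iii) $\mathsf b_{2,2}( *,m)=2^{m+1}C(m)$.
   Context: $C(m)=\frac1{m+1}\binom{2m}{m}$ denotes the Catalan number, and a binomial coefficient $\binom{a}{b}$ with $a\ge 0$ is $0$ when $b<0$ or $b>a$. \textbf{Decorated trees.} In a rooted planar tree, a node is a leaf if it has no children and internal otherwise; an angle is the sector between two consecutive children of an internal node. $\mathcal T_{2,2}$ is the set of finite rooted planar trees with at least one internal node, with each angle labeled by $1$ and each internal node labeled by $0$ or $1$, such that: every internal node has at least two children; among the children of each node only the leftmost and rightmost can be leaves; only the root may have label $0$ (all other internal nodes have label $1$). $\deg_{\mathrm{node}}(t)$ is the sum of the internal node labels of $t$ and $\deg_{\mathrm{angle}}(t)$ is the sum of its angle labels (i.e. the number of angles). $\mathcal T_{2,2}(n,m)$ is the set of $t\in\mathcal T_{2,2}$ with $\deg_{\mathrm{angle}}(t)=n$ and $\deg_{\mathrm{node}}(t)=m$. $B_{2,2}$ is the free $\Bbbk$-module on $\mathcal T_{2,2}$ ($\Bbbk$ a commutative ring), and $B_{2,2}(n,m)$ is the submodule with basis $\mathcal T_{2,2}(n,m)$; $B_{2,2}(n,* )=\bigoplus_{m\ge0}B_{2,2}(n,m)$ and $B_{2,2}( *,m)=\bigoplus_{n\ge1}B_{2,2}(n,m)$.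 $\mathsf b_{2,2}(n,m)$, $\mathsf b_{2,2}(n,* )$, $\mathsf b_{2,2}( *,m)$ denote the dimensions (ranks, i.e. numbers of basis trees) of $B_{2,2}(n,m)$, $B_{2,2}(n,* )$, $B_{2,2}( *,m)$ respectively. ($B_{2,2}$ underlies the free Baxter algebra with a quasi-idempotent operator and an idempotent generator.) \textbf{Paths.} $\mathcal{RP}(n,m)$ is the set of lattice paths from $(0,0)$ to $(n,n)$ with steps $H=(1,0)$, $V=(0,1)$, $D=(1,1)$, never rising above the diagonal $y=x$, with exactly $n-m$ steps $D$, and such that each diagonal step is followed by a horizontal step, except if it is the last step. A Motzkin path of length $\ell$ is a lattice path from $(0,0)$ to $(\ell,0)$ with steps $U=(1,1)$, $H=(1,0)$, $D=(1,-1)$, never crossing below the $x$-axis. $\mathcal{MP}_{hu}(n)$ is the set of $(h,u)$-colored Motzkin paths from $(0,0)$ to $(n-1,0)$: Motzkin paths of length $n-1$ each of whose horizontal steps and each of whose up steps is colored with one of two colors.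
   Formalization: Clause (iii) is stated for m ≥ 1 only: at m = 0 the only tree is the root labeled 0 with two leaves, so b_{2,2}( *,0) = 1, not 2·C(0) = 2; also the ring k is assumed nonzero so that ranks are well defined. *)

(* Defs.v *)
From HB Require Import structures.
From mathcomp Require Import all_boot all_order all_algebra.
From mathcomp Require Import finmap.
From mathcomp.multinomials Require Import monalg.

Set Implicit Arguments.
Unset Strict Implicit.
Unset Printing Implicit Defensive.

Import GRing.Theory Num.Theory.

(* The division is exact. *)
Definition catalan (m : nat) : nat := 'C(2 * m, m) %/ m.+1.

(* 'C(a, b) with b in int, equal to 0 for b < 0. *)
Definition binz (a : nat) (b : int) : nat := if b is Posz c then 'C(a, c) else 0.

(* [GenTree.Leaf tt] is a leaf; [GenTree.Node l s] is an internal node with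
   label l and children s from left to right (the empty list s, which would
   also be childless, is excluded by [children_ok]). Angle labels are all 1 in
   T_{2,2}, so they are not stored: the angles of [GenTree.Node l s] are its
   [size s - 1] pairs of consecutive children. *)
Notation ptree := (GenTree.tree unit).

Definition is_internal (t : ptree) : bool :=
  if t is GenTree.Node _ _ then true else false.

(* All internal nodes, as pairs (label, children), the root being the head. *)
Fixpoint internal_nodes (t : ptree) : seq (nat * seq ptree) :=
  if t is GenTree.Node l s then (l, s) :: flatten [seq internal_nodes u | u <- s]
  else [::].

(* [behead (take (size s).-1 s)] is s without its first and last items. *)
Definition children_ok (s : seq ptree) : bool :=
  (2 <= size s) && all is_internal (behead (take (size s).-1 s)).

Definition is_T22 (t : ptree) : bool :=
  [&& is_internal t,
      all (fun v => children_ok v.2) (internal_nodes t),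
      all (fun v => v.1 <= 1) (internal_nodes t)
    & all (fun v => v.1 == 1) (behead (internal_nodes t))].

Definition T22 := {t : ptree | is_T22 t}.

Definition deg_node (t : T22) : nat :=
  \sum_(v <- internal_nodes (val t)) v.1.

Definition deg_angle (t : T22) : nat :=
  \sum_(v <- internal_nodes (val t)) (size v.2).-1.

Local Open Scope ring_scope.

(* {malg k[T]} is the free k-module on T (finitely supported functions). *)
Definition B22 (k : comNzRingType) := {malg k[T22]}.
HB.instance Definition _ (k : comNzRingType) := GRing.Lmodule.on (B22 k).

Definition B22_hom (k : comNzRingType) (n m : nat) (x : B22 k) : Prop :=
  forall t : T22, t \in msupp x -> deg_angle t = n /\ deg_node t = m.

(* The submodule of V that is the sum of the B i, i : nat. *)
Definition internal_sum (V : zmodType) (B : nat -> V -> Prop) (x : V) : Prop :=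
  exists (N : nat) (y : 'I_N -> V),
    (forall i : 'I_N, B i (y i)) /\ x = \sum_(i < N) y i.

Definition B22_angle (k : comNzRingType) (n : nat) : B22 k -> Prop :=
  internal_sum (fun m => B22_hom (k := k) n m).

Definition B22_node (k : comNzRingType) (m : nat) : B22 k -> Prop :=
  internal_sum (fun n => B22_hom (k := k) n.+1 m).

(* The submodule S of V has a k-basis of r elements; r is then unique, since
   k is commutative and nonzero. *)
Definition has_rank (k : comNzRingType) (V : lmodType k) (S : V -> Prop)
    (r : nat) : Prop :=
  exists e : 'I_r -> V, (forall i, S (e i)) /\
    (forall x, S x -> exists! c : 'rV[k]_r, x = \sum_(i < r) c 0 i *: e i).

Local Close Scope ring_scope.

Variant rstep := RH | RV | RD.

Definition rstep_code (s : rstep) : option bool :=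
  match s with RH => Some true | RV => Some false | RD => None end.
Definition rstep_decode (o : option bool) : rstep :=
  match o with Some true => RH | Some false => RV | None => RD end.
Lemma rstep_codeK : cancel rstep_code rstep_decode. Proof. by case. Qed.
HB.instance Definition _ := Finite.copy rstep (can_type rstep_codeK).

Definition xcoord (w : seq rstep) : nat := \sum_(s <- w) (s != RV).
Definition ycoord (w : seq rstep) : nat := \sum_(s <- w) (s != RH).

Definition is_RP (n m : nat) (w : seq rstep) : bool :=
  [&& xcoord w == n, ycoord w == n,
      all (fun i => ycoord (take i w) <= xcoord (take i w)) (iota 0 (size w).+1),
      Posz (count_mem RD w) == (n%:Z - m%:Z)%R
    & sorted (fun s1 s2 => (s1 == RD) ==> (s2 == RH)) w].

(* A path from (0,0) to (n,n) has at most 2n steps, so the length bound only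
   serves to make the ambient type finite. *)
Definition RP (n m : nat) : {set (2 * n).-bseq rstep} :=
  [set w : (2 * n).-bseq rstep | is_RP n m w].

(* Up and horizontal steps carry one of two colors. *)
Variant mstep := MU of bool | MH of bool | MD.

Definition mstep_code (s : mstep) : option (bool + bool) :=
  match s with MU c => Some (inl c) | MH c => Some (inr c) | MD => None end.
Definition mstep_decode (o : option (bool + bool)) : mstep :=
  match o with Some (inl c) => MU c | Some (inr c) => MH c | None => MD end.
Lemma mstep_codeK : cancel mstep_code mstep_decode. Proof. by case. Qed.
HB.instance Definition _ := Finite.copy mstep (can_type mstep_codeK).

Definition rise (s : mstep) : int :=
  match s with MU _ => 1%R | MH _ => 0%R | MD => (- 1)%R end.

Definition height (w : seq mstep) : int := (\sum_(s <- w) rise s)%R.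

Definition is_Motzkin (w : seq mstep) : bool :=
  (height w == 0%R) &&
  all (fun i => (0 <= height (take i w))%R) (iota 0 (size w).+1).

(* Every step advances the abscissa by 1: length n - 1 means n - 1 steps. *)
Definition MPhu (n : nat) : {set n.-1.-tuple mstep} :=
  [set w : n.-1.-tuple mstep | is_Motzkin w].

(* The only tree of node degree 0 has two leaves and one angle, hence the
   component of node degree 0 has rank 1, and not 2 ^ 1 * catalan 0 = 2. *)
Lemma T22_deg_node0 (t : T22) : deg_node t = 0 ->
  val t = GenTree.Node 0 [:: GenTree.Leaf tt; GenTree.Leaf tt].
Proof.
case: t => -[//|l s] /= tP; rewrite /deg_node /= big_cons /=.
case/and4P: tP => _ /andP[/= ok _] _ lab /eqP.
rewrite addn_eq0 => /andP[/eqP -> sum0]; congr GenTree.Node.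
have {lab sum0} s0 : flatten [seq internal_nodes u | u <- s] = [::].
  case: (flatten _) lab sum0 => //= v r /andP[/eqP v1 _].
  by rewrite big_cons v1.
case: s s0 ok => [|[[]|? ?] [|[[]|? ?] [|[[]|? ?] s]]] //=; by case: s.
Qed.

(* Main.v *)
Require Import Defs.
From mathcomp Require Import all_boot all_order all_algebra.
From mathcomp Require Import finmap zify.
From mathcomp.multinomials Require Import monalg.

(** Let F(x, y) be the generating function of the trees of T22 together with
the bare leaf, where x marks angles and y marks node labels. Everything rests
on the equation F = 1 + x + x y F^2. The terms 1 and x are the leaf and the
cherry (root labeled 0, two leaves); every other tree is obtained exactly once
by [graft]ing an ordered pair of trees, an operation that adds up both degrees
and increases each of them by 1 ([graft_valid], [graftK], [ungraftK],
[graft_angles], [graft_nodes]).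

So these trees behave like binary trees whose inner nodes weigh x y and whose
leaves weigh 1 or x. There are C(m) binary trees with m inner nodes, and
n - m of their m + 1 leaves must be chosen to weigh x: this is the number
C(m) binom(m + 1, n - m) in (i), and ignoring the choice gives 2^(m + 1) C(m)
in (iii). No power series are used: one counts forests of h trees, peeling off
the first tree, which is a leaf, a cherry, or a grafted pair that is put back
into the forest as two trees. This is the recurrence of the ballot numbers
([has_card_forest_nodes]), whose case h = 1 is Catalan ([ballot_catalan]).

A path of RP(n, m) is a ballot path with m steps H and m steps V into which
n - m steps D are inserted, at most one in each of the m + 1 slots found before
a step H or at the end; peeling off first steps leads to the same numbers
([has_card_rp_words]).

For (ii), put y = 1 and B = F - 1, the series of T22 by angles. Then
B = 2 x + 2 x B + x B^2, whereas the series M of two-colored Motzkin paths by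
length satisfies M = 1 + 2 x M + 2 x^2 M^2; so B = 2 x M. On coefficients,
forests of h + 1 trees of T22 with n + 1 angles satisfy the same recurrence as
2^(h + 1) times the Motzkin paths of n steps from height h down to 0
([proper_countS], [has_card_proper_forest]).

Finally, a submodule of B22 consisting of the combinations of a finite set of
trees has these trees as a basis ([has_rank_monomials]). *)

Set Implicit Arguments.
Unset Strict Implicit.
Unset Printing Implicit Defensive.

Import GRing.Theory.

(** * Cardinals of decidable predicates *)

(** The predicates to be counted live on infinite types of words and trees, so
finiteness is part of the assertion. *)
Definition has_card (T : eqType) (P : pred T) (c : nat) : Prop :=
  exists s : seq T, [/\ uniq s, s =i P & size s = c].

Lemma eq_has_card (T : eqType) (P Q : pred T) c :
  has_card P c -> P =1 Q -> has_card Q c.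
Proof.
by case=> s [us sP sc] eqPQ; exists s; split=> // x; rewrite sP; apply: eqPQ.
Qed.

Lemma has_card0 (T : eqType) (P : pred T) : P =1 xpred0 -> has_card P 0.
Proof. by move=> P0; exists [::]; split=> // x; exact/esym/P0. Qed.

Lemma has_card1 (T : eqType) (x : T) : has_card (pred1 x) 1.
Proof. by exists [:: x]; split=> // y; rewrite inE. Qed.

Lemma has_cardU (T : eqType) (P Q : pred T) c d :
    (forall x, P x -> ~~ Q x) -> has_card P c -> has_card Q d ->
  has_card (predU P Q) (c + d).
Proof.
move=> disj [s [us sP <-]] [t [ut tQ <-]]; exists (s ++ t); split.
- rewrite cat_uniq us ut andbT; apply/hasPn => x; rewrite tQ sP => Qx.
  by apply: contraL Qx => /disj.
- by move=> x; rewrite mem_cat sP tQ.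
- by rewrite size_cat.
Qed.

Lemma has_card_bij (T U : eqType) (P : pred T) (Q : pred U) f g c :
    (forall x, P x -> Q (f x) /\ g (f x) = x) ->
    (forall y, Q y -> P (g y) /\ f (g y) = y) ->
  has_card P c -> has_card Q c.
Proof.
move=> fP gQ [s [us sP <-]]; exists (map f s); split; last by rewrite size_map.
- rewrite map_inj_in_uniq // => x y; rewrite !sP => Px Py fxy.
  by rewrite -(fP x Px).2 fxy (fP y Py).2.
- move=> y; apply/mapP/idP => [[x]|Qy]; first by rewrite sP => /fP[Qfx _] ->.
  by have [Pgy fgy] := gQ y Qy; exists (g y); rewrite ?sP.
Qed.

Definition headed (T : eqType) (a : T) (P : pred (seq T)) : pred (seq T) :=
  fun w => if w is b :: w' then (b == a) && P w' else false.

Lemma has_card_headed (T : eqType) (a : T) (P : pred (seq T)) c :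
  has_card P c -> has_card (headed a P) c.
Proof.
apply: (has_card_bij (f := cons a) (g := behead)) => [w Pw|[|b w] //=].
  by rewrite /= eqxx.
by case/andP=> /eqP ->.
Qed.

(** Peeling off the first letter turns the counts of paths below into numerical
recurrences. *)
Lemma has_card_heads (T : eqType) (letters : seq T) (P : pred (seq T)) c :
    uniq letters -> (forall a, a \in letters) ->
    (forall a, has_card (fun w => P (a :: w)) (c a)) ->
  has_card P (P [::] + \sum_(a <- letters) c a).
Proof.
move=> ul lT Pc; have {lT} PE: P =1 predU (fun w => nilp w && P [::])
    (fun w => if w is a :: w' then (a \in letters) && P w else false).
  by case=> [|a w] /=; rewrite ?orbF ?lT.
apply: eq_has_card (fsym PE); apply: has_cardU; first by case.
  case P0 : (P [::]); last by apply: has_card0 => w; rewrite andbF.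
  by apply: (eq_has_card (has_card1 [::])) => -[|a w].
elim: letters ul {PE} => [|a l IHl] /=.
  by rewrite big_nil => _; apply: has_card0 => -[].
case/andP=> al /IHl cl; rewrite big_cons.
apply: (eq_has_card (has_cardU _ (has_card_headed a (Pc a)) cl))
  => [[|b w]|[|b w]] //=.
  by case/andP=> /eqP -> _; rewrite (negbTE al).
by rewrite inE; case: eqP => [->|] //=; rewrite (negbTE al) orbF.
Qed.

Lemma card_of_has_card (F : finType) (T : eqType) (v : F -> T) (A : {set F})
    (P : pred T) c :
    injective v -> (forall x, (x \in A) = P (v x)) ->
    (forall y, P y -> exists x, v x = y) ->
  has_card P c -> #|A| = c.
Proof.
move=> v_inj AP Pv [s [us sP <-]].
rewrite cardE -(size_map v); apply/perm_size/uniq_perm => //.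
  by rewrite map_inj_uniq ?enum_uniq.
move=> y; rewrite sP; apply/mapP/idP => [[x]|Py].
  by rewrite mem_enum AP => Px ->.
by have [x vx] := Pv y Py; exists x => //; rewrite mem_enum AP vx.
Qed.

Lemma has_card_sub (T : eqType) (p : pred T) (sT : subEqType p) (P : pred T) c :
    (forall x, P x -> p x) -> has_card P c ->
  has_card (fun x : sT => P (val x)) c.
Proof.
move=> Pp [s [us sP <-]]; exists (pmap insub s); split.
- exact: pmap_sub_uniq.
- by move=> x; rewrite mem_pmap_sub sP.
- rewrite size_pmap_sub; apply/eqP; rewrite -all_count.
  by apply/allP => x; rewrite sP => /Pp.
Qed.

Lemma has_card_singletons (T : eqType) (P : pred (seq T)) c :
    (forall w, P w -> size w = 1) -> has_card P c ->
  has_card (fun x => P [:: x]) c.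
Proof.
move=> P1 [[|w0 s] [us sP <-]].
  by exists [::]; split=> // x; rewrite -[LHS]/([:: x] \in [::]) sP.
have: P w0 by rewrite -[P w0]sP mem_head.
case: w0 us sP => [|x0 w0] us sP; first by move/P1.
move=> _; apply: (has_card_bij (f := head x0) (g := fun x => [:: x]));
  last by (exists ((x0 :: w0) :: s); split).
- by case=> [|x [|y w]] Pw; have := P1 _ Pw.
- by [].
Qed.

(** * Ballot numbers and subset counts *)

(** The ballot numbers, indexed so that [ballot u h] counts the forests of [h]
binary trees with [u] inner nodes in all: unless it is a leaf, the first tree
can be replaced by its two subtrees, whence [ballotSS]. *)
Fixpoint ballot (u h : nat) : nat :=
  if u is u'.+1 then \sum_(i < h) ballot u' i.+2 else 1.

Lemma ballotS0 u : ballot u.+1 0 = 0.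
Proof. by rewrite /= big_ord0. Qed.

Lemma ballotSS u h : ballot u.+1 h.+1 = ballot u.+1 h + ballot u h.+2.
Proof. by rewrite /= big_ord_recr. Qed.

(** Combinatorially, this is the reflection principle: the second term counts
the words in two letters that hit the forbidden line. Here, both sides turn out
to satisfy the recurrence of Pascal, with the same boundary values. *)
Lemma ballot_binomial u h :
  ballot u.+1 h + 'C(u.*2 + h.+1, u) = 'C(u.*2 + h.+1, u.+1).
Proof.
elim: u h => [|u IHu]; elim=> [|h IHh].
- by rewrite ballotS0.
- by rewrite ballotSS /= !bin0 !bin1 in IHh *; lia.
- rewrite ballotS0 add0n addn1 -bin_sub; last by lia.
  by congr 'C(_, _); lia.
rewrite ballotSS addnS [in RHS]binS [in LHS]binS.
have := IHu h.+2; rewrite (_ : u.*2 + h.+3 = u.+1.*2 + h.+1); last by lia.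
by move: IHh; lia.
Qed.

Lemma ballot_catalan m : ballot m 1 = catalan m.
Proof.
rewrite /catalan; case: m => [|m]; first by [].
have Bs := ballot_binomial m 1; have Bd := mul_bin_left (m.+1).*2 m.
have E : (m.+1).*2 = m.*2 + 2 by lia.
rewrite mul2n; have <- : ballot m.+1 1 * m.+2 = 'C(m.+1.*2, m.+1).
  move: Bs Bd; rewrite -E.
  rewrite (_ : m.+1.*2 - m = m.+2); last by lia.
  by nia.
by rewrite mulnK.
Qed.

(** The number of subsets of an [a]-element set whose size satisfies [Q]. The
predicate covers at once a prescribed size, which gives binomial coefficients,
and no constraint at all, which gives powers of 2. *)
Fixpoint subset_count (a : nat) (Q : pred nat) : nat :=
  if a is a'.+1 then subset_count a' Q + subset_count a' (fun d => Q d.+1)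
  else Q 0.

Lemma subset_countS a (Q : pred nat) : subset_count a.+1 Q =
  subset_count a Q + subset_count a (fun d => Q d.+1).
Proof. by []. Qed.

Lemma eq_subset_count a (Q Q' : pred nat) :
  Q =1 Q' -> subset_count a Q = subset_count a Q'.
Proof.
elim: a Q Q' => [|a IHa] Q Q' QQ' /=; first by rewrite QQ'.
by congr (_ + _); apply: IHa => // d; apply: QQ'.
Qed.

Lemma subset_countT a : subset_count a xpredT = 2 ^ a.
Proof. by elim: a => //= a ->; rewrite expnS mul2n addnn. Qed.

Lemma subset_count0 a : subset_count a xpred0 = 0.
Proof. by elim: a => //= a ->. Qed.

Lemma subset_count1 a d : subset_count a (pred1 d) = 'C(a, d).
Proof.
elim: a d => [|a IHa] [|d] //=; rewrite IHa.
  by rewrite (@eq_subset_count a _ xpred0) // subset_count0 !bin0.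
by rewrite (@eq_subset_count a _ (pred1 d)) // IHa binS.
Qed.

(** * Lattice paths *)

Lemma all_prefix (T : Type) (p : pred (seq T)) a w :
  all (fun i => p (take i (a :: w))) (iota 0 (size w).+2)
  = p [::] && all (fun i => p (a :: take i w)) (iota 0 (size w).+1).
Proof.
rewrite -[iota 0 _.+2]/(0 :: iota (1 + 0) (size w).+1) iotaDl.
by rewrite (all_cat _ [:: 0] (map _ _)) all_map /= andbT.
Qed.

(** Suffixes of the paths of RP from a point at horizontal distance [h] from
the diagonal: the conditions on coordinates of prefixes become a recursive
check, suited to counting by the first step. *)
Fixpoint rp_from (h : nat) (w : seq rstep) : bool :=
  match w with
  | [::] => h == 0
  | RH :: w' => rp_from h.+1 w'
  | RV :: w' => if h is h'.+1 then rp_from h' w' else false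
  | RD :: w' => (if w' is s :: _ then s == RH else true) && rp_from h w'
  end.

Lemma rp_fromE h w : rp_from h w =
  [&& ycoord w == h + xcoord w,
      all (fun i => ycoord (take i w) <= h + xcoord (take i w))
          (iota 0 (size w).+1)
    & sorted (fun s1 s2 => (s1 == RD) ==> (s2 == RH)) w].
Proof.
elim: w h => [|s w IHw] h; first by rewrite /ycoord /xcoord /= !big_nil; lia.
have E a u : (ycoord (a :: u) = (a != RH) + ycoord u)
   * (xcoord (a :: u) = (a != RV) + xcoord u).
  by rewrite /ycoord /xcoord !big_cons.
rewrite (all_prefix (fun u => ycoord u <= h + xcoord u)).
have [r0 ->] : 0 \in iota 0 (size w).+1 /\ (ycoord [::] <= h + xcoord [::]).
  by rewrite mem_iota /ycoord /xcoord !big_nil.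
move: (iota 0 (size w).+1) r0 IHw => r r0 IHw.
have sortedE : sorted (fun s1 s2 => (s1 == RD) ==> (s2 == RH)) (s :: w)
    = (if w is s' :: _ then (s == RD) ==> (s' == RH) else true)
      && sorted (fun s1 s2 => (s1 == RD) ==> (s2 == RH)) w.
  by case: w {IHw}.
rewrite sortedE !E.
case: s {sortedE} => /=.
- rewrite IHw; congr [&& _, _ & _]; first by lia.
    by apply: eq_all => i; rewrite !E /=; lia.
  by case: w {IHw}.
- case: h => [|h].
    apply/esym/negP => /and3P[_ /allP/(_ 0 r0)].
    by rewrite take0 !E /= /ycoord /xcoord !big_nil.
  rewrite IHw; congr [&& _, _ & _].
    by apply: eq_all => i; rewrite !E /=; lia.
  by case: w {IHw}.
- rewrite IHw; case: (match w with [::] => _ | s :: _ => _ end).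
    rewrite !andTb; congr [&& _, _ & _]; first by lia.
    by apply: eq_all => i; rewrite !E /=; lia.
  by rewrite /= !andbF.
Qed.

Lemma size_rpath w : size w = count_mem RH w + count_mem RV w + count_mem RD w.
Proof. by elim: w => //= -[] w /= ->; lia. Qed.

Lemma xcoordE w : xcoord w = count_mem RH w + count_mem RD w.
Proof.
rewrite /xcoord; elim: w => [|s w IHw]; first by rewrite big_nil.
by rewrite big_cons IHw; case: s => /=; lia.
Qed.

Lemma ycoordE w : ycoord w = count_mem RV w + count_mem RD w.
Proof.
rewrite /ycoord; elim: w => [|s w IHw]; first by rewrite big_nil.
by rewrite big_cons IHw; case: s => /=; lia.
Qed.

Definition rp_words h u d : pred (seq rstep) :=
  fun w => [&& rp_from h w, count_mem RH w == u & count_mem RD w == d].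

(** A step D is admissible only at the end or before a step H, so a word without
its steps D is counted by [ballot u h.+1], and the steps D occupy [d] of
[u.+1] slots. The proof checks that the product satisfies the
recurrence on the first step, D and the following H counting as one. *)
Lemma has_card_rp_words h u d :
  has_card (rp_words h u d) (ballot u h.+1 * 'C(u.+1, d)).
Proof.
elim: u h d => [|u IHu] h d.
  rewrite mul1n; elim: h => [|h IHh].
    case: d => [|[|d]]; rewrite ?bin0 ?bin1 ?(@bin_small 1) //.
    - apply: (eq_has_card (has_card1 [::])) => -[|[] w];
        by rewrite /rp_words /= ?andbF.
    - apply: (eq_has_card (has_card1 ([:: RD] : seq rstep))).
      by case=> [|[] [|[] w]]; rewrite /rp_words /= ?andbF.
    - by apply: has_card0 => -[|[] [|[] w]]; rewrite /rp_words /= ?andbF.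
  apply: (eq_has_card (has_card_headed RV IHh)) => -[|[] w] //.
  - by rewrite /rp_words /= andbF.
  - by rewrite /rp_words /=; case: w => [|[] w]; rewrite /= ?andbF //.
have step k :
    has_card (fun w => rp_words k u.+1 d (RV :: w))
      (ballot u.+1 k * 'C(u.+2, d)) ->
    has_card (rp_words k u.+1 d) (ballot u.+1 k.+1 * 'C(u.+2, d)).
  move=> cV; have cD : has_card (fun w => rp_words k u.+1 d (RD :: w))
      (ballot u k.+2 * (if d is d'.+1 then 'C(u.+1, d') else 0)).
    case: d {cV} => [|d].
      by rewrite muln0; apply: has_card0 => w; rewrite /rp_words /= !andbF.
    apply: (eq_has_card (has_card_headed RH (IHu _ _))) => -[|[] w].
    - by rewrite /rp_words /= andbF.
    - by rewrite /rp_words /= !eqSS.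
    - by [].
    - by [].
  (* The D in front of an H leaves [d.-1] steps D, so the first and last terms
     add up by the identity of Pascal. *)
  have -> : ballot u.+1 k.+1 * 'C(u.+2, d) = rp_words k u.+1 d [::]
      + \sum_(a <- [:: RH; RV; RD]) match a with
        | RH => ballot u k.+2 * 'C(u.+1, d)
        | RV => ballot u.+1 k * 'C(u.+2, d)
        | RD => ballot u k.+2 * (if d is d'.+1 then 'C(u.+1, d') else 0)
        end.
    rewrite !big_cons big_nil addn0 {1}/rp_words andbF add0n addnCA -mulnDr.
    rewrite ballotSS mulnDl; congr (_ + _ * _).
    by case: d {cV cD} => [|d]; rewrite ?bin0 // binS.
  apply: has_card_heads => [||[]] //; first by case.
  by apply: (eq_has_card (IHu k.+1 d)) => w; rewrite /rp_words /= eqSS.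
elim: h => [|h IHh]; apply: step.
  by rewrite ballotS0; apply: has_card0.
exact: IHh.
Qed.

Fixpoint mp_from (h : nat) (w : seq mstep) : bool :=
  match w with
  | [::] => h == 0
  | MU _ :: w' => mp_from h.+1 w'
  | MH _ :: w' => mp_from h w'
  | MD :: w' => if h is h'.+1 then mp_from h' w' else false
  end.

Lemma mp_fromE h w : mp_from h w =
  (Posz h + height w == 0)%R &&
  all (fun i => (0 <= Posz h + height (take i w))%R) (iota 0 (size w).+1).
Proof.
elim: w h => [|s w IHw] h; first by rewrite /height /= !big_nil; lia.
have E a u : height (a :: u) = (rise a + height u)%R.
  by rewrite /height big_cons.
rewrite (all_prefix (fun u => 0 <= Posz h + height u)%R).
have [r0 ->] : 0 \in iota 0 (size w).+1 /\ (0 <= Posz h + height [::])%R.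
  by rewrite mem_iota /height !big_nil; lia.
move: (iota 0 (size w).+1) r0 IHw => r r0 IHw; rewrite E andTb.
have stepE h' : (Posz h' = Posz h + rise s)%R -> mp_from h' w =
    (Posz h + (rise s + height w) == 0)%R &&
    all (fun i => 0 <= Posz h + height (s :: take i w))%R r.
  move=> hh'; rewrite IHw hh' GRing.addrA; congr (_ && _).
  by apply: eq_all => i; rewrite E GRing.addrA.
case: s stepE => [c|c|] stepE; [by apply: stepE => /=; lia..|].
case: h stepE => [|h] stepE; last by apply: stepE => /=; lia.
apply/esym/negP => /andP[_ /allP/(_ 0 r0)].
by rewrite take0 E /= /height big_nil.
Qed.

Fixpoint motzkin (N h : nat) : nat :=
  if N is N'.+1 then
    2 * motzkin N' h.+1 + 2 * motzkin N' h
    + (if h is h'.+1 then motzkin N' h' else 0)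
  else h == 0.

Lemma has_card_mp_from N h :
  has_card (fun w => (size w == N) && mp_from h w) (motzkin N h).
Proof.
elim: N h => [|N IHN] h.
  case: h => [|h]; last by apply: has_card0 => -[].
  by apply: (eq_has_card (has_card1 [::])) => -[].
have -> : motzkin N.+1 h = ((size (Nil mstep) == N.+1) && mp_from h [::])
    + \sum_(a <- [:: MU true; MU false; MH true; MH false; MD]) match a with
      | MU _ => motzkin N h.+1
      | MH _ => motzkin N h
      | MD => if h is h'.+1 then motzkin N h' else 0
      end.
  by rewrite !big_cons big_nil /=; lia.
apply: (@has_card_heads _ _ (fun w => (size w == N.+1) && mp_from h w)).
- by [].
- by case=> [[]|[]|].
case=> [c|c|]; [exact: (IHN h.+1)|exact: (IHN h)|].
case: h => [|h]; last exact: (IHN h).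
by apply: has_card0 => w; rewrite /= andbF.
Qed.

Lemma card_MPhu n : 0 < n -> #|MPhu n| = motzkin n.-1 0.
Proof.
case: n => // n _.
apply: (card_of_has_card (v := val)) (has_card_mp_from n 0)
  => [|w|w /andP[sw _]].
- exact: val_inj.
- rewrite inE size_tuple eqxx mp_fromE GRing.add0r.
  by under eq_all do rewrite GRing.add0r.
- by exists (Tuple sw).
Qed.

Lemma card_RP n m : m <= n -> #|RP n m| = ballot m 1 * 'C(m.+1, n - m).
Proof.
move=> mn.
apply: (card_of_has_card (v := val)) (has_card_rp_words 0 m (n - m)) => [|w|w].
- exact: val_inj.
- rewrite inE /rp_words rp_fromE /is_RP xcoordE ycoordE add0n.
  rewrite (eq_all (fun i => erefl : (ycoord (take i w) <= 0 + xcoord (take i w))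
    = (ycoord (take i w) <= xcoord (take i w)))).
  move: (all _ _) (sorted _ _) => a b /=.
  move: (count_mem RH w) (count_mem RV w) (count_mem RD w) => x y z.
  by case: a; case: b; rewrite ?andbF //=; lia.
case/and3P; rewrite rp_fromE => /and3P[/eqP].
rewrite xcoordE ycoordE => yx _ _ /eqP xm /eqP dm.
have sw : size w <= 2 * n by rewrite size_rpath; lia.
by exists (Bseq sw).
Qed.

(** * Trees and grafting *)

Local Notation Node := GenTree.Node.
Local Notation leaf := (GenTree.Leaf tt).

Definition cherry : ptree := Node 0 [:: leaf; leaf].

(** The condition on the proper subtrees of a tree of T22. *)
Definition all_ones (t : ptree) : bool :=
  all (fun v => children_ok v.2 && (v.1 == 1)) (internal_nodes t).

(** T22 together with the bare leaf, the term 1 of F, so that grafting on one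
side only is a special case of grafting a pair. *)
Definition valid (t : ptree) : bool :=
  if t is Node l s then [&& l <= 1, children_ok s & all all_ones s] else true.

Definition angles (t : ptree) := \sum_(v <- internal_nodes t) (size v.2).-1.
Definition nodes (t : ptree) := \sum_(v <- internal_nodes t) v.1.

Lemma all_internal_nodes (p : pred (nat * seq ptree)) l s :
  all p (internal_nodes (Node l s))
  = p (l, s) && all (fun u => all p (internal_nodes u)) s.
Proof.
by rewrite /=; congr (_ && _); elim: s => //= u s <-; rewrite all_cat.
Qed.

Lemma is_T22E t : is_T22 t = is_internal t && valid t.
Proof.
case: t => // l s; rewrite /is_T22 [valid _]/= !all_internal_nodes /=.
have -> : all all_ones s
    = all (fun u => all (fun v => children_ok v.2) (internal_nodes u)) s
      && all (fun u => all (fun v => v.1 == 1) (internal_nodes u)) s.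
  by rewrite -all_predI; apply: eq_all => u /=; rewrite -all_predI.
have -> : all (fun v => v.1 == 1) (flatten [seq internal_nodes u | u <- s])
    = all (fun u => all (fun v => v.1 == 1) (internal_nodes u)) s.
  by elim: s => //= u s <-; rewrite all_cat.
have: all (fun u => all (fun v => v.1 == 1) (internal_nodes u)) s ->
    all (fun u => all (fun v => v.1 <= 1) (internal_nodes u)) s.
  by apply: sub_all => u; apply: sub_all => v /eqP ->.
move=> ones_le1; apply/idP/idP.
  by case/and3P=> /andP[-> ->] /andP[-> _] ->.
by case/and4P=> -> -> -> ones; rewrite ones ones_le1.
Qed.

Lemma anglesE l s : angles (Node l s) = (size s).-1 + \sum_(u <- s) angles u.
Proof. by rewrite /angles /= big_cons big_flatten big_map. Qed.

Lemma nodesE l s : nodes (Node l s) = l + \sum_(u <- s) nodes u.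
Proof. by rewrite /nodes /= big_cons big_flatten big_map. Qed.

Lemma angles_leaf : angles leaf = 0.
Proof. by rewrite /angles big_nil. Qed.

Lemma nodes_leaf : nodes leaf = 0.
Proof. by rewrite /nodes big_nil. Qed.

Lemma children_ok_insert a b r :
    0 < size r ->
  children_ok [:: a, b & r] = is_internal b && children_ok (a :: r).
Proof. by case: r => // c r _; rewrite /children_ok. Qed.

(** The pairing behind x y F^2. In each of the two trees, only the root label
is free to be 0. If at most one of them is internal, they become the two
children of a new root, which takes over the free label (or is labeled 1 if
there is none), and the former root gets label 1. If both are internal, there
are two free labels for one root: that of [y] is kept as a label and that of
[x] is recorded in the shape. If the latter is 1, the trees become the two
children of a new root; if it is 0, the tree [x] is relabeled 1 and inserted as
second child of [y], whose root then has at least three children. The last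
value only arises when [y] violates [children_ok]. *)
Definition graft (x y : ptree) : ptree :=
  match x, y with
  | GenTree.Leaf _, GenTree.Leaf _ => Node 1 [:: leaf; leaf]
  | Node l s, GenTree.Leaf _ => Node l [:: Node 1 s; leaf]
  | GenTree.Leaf _, Node l s => Node l [:: leaf; Node 1 s]
  | Node l s, Node l' s' =>
      if l == 1 then Node l' [:: Node 1 s; Node 1 s']
      else if s' is a :: r then Node l' [:: a, Node 1 s & r] else leaf
  end.

Definition ungraft (t : ptree) : ptree * ptree :=
  if t is Node l s then
    match s with
    | [:: GenTree.Leaf _; GenTree.Leaf _] => (leaf, leaf)
    | [:: Node _ s1; GenTree.Leaf _] => (Node l s1, leaf)
    | [:: GenTree.Leaf _; Node _ s2] => (leaf, Node l s2)
    | [:: Node _ s1; Node _ s2] => (Node 1 s1, Node l s2)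
    | [:: a, Node _ s1 & r] => (Node 0 s1, Node l (a :: r))
    | _ => (leaf, leaf)
    end
  else (leaf, leaf).

Lemma all_ones_Node l s :
  all_ones (Node l s) = [&& l == 1, children_ok s & all all_ones s].
Proof. by rewrite /all_ones all_internal_nodes /= andbAC andbC -andbA. Qed.

Lemma graft_valid x y : valid x -> valid y ->
  [/\ is_internal (graft x y), valid (graft x y) & graft x y != cherry].
Proof.
case: x => [[]|l s]; case: y => [[]|l' s'] //= vx vy.
- case/and3P: vy => l'1 c' o'; rewrite all_ones_Node /= l'1 c' o'.
  by split=> //; apply/eqP => -[].
- case/and3P: vx => l1 c o; rewrite all_ones_Node /= l1 c o.
  by split=> //; apply/eqP => -[].
case/and3P: vx => l1 c o; case/and3P: vy => l'1 c' o'.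
case: eqP => _.
  by rewrite /= !all_ones_Node l'1 c c' o o'; split=> //; apply/eqP => -[].
case: s' c' o' => [|a [|b r]] // c' /= /and3P[oa ob or].
rewrite children_ok_insert // c' all_ones_Node c o oa ob or l'1.
by split=> //; apply/eqP => -[].
Qed.

(** With two children, the leaves among them show which of the trees were
leaves, and two internal children mean that the left root label was 1; with
three children or more, it was 0. *)
Lemma graftK x y : valid x -> valid y -> ungraft (graft x y) = (x, y).
Proof.
case: x => [[]|l s]; case: y => [[]|l' s'] //= vx vy.
case/and3P: vx => l1 c o; case/and3P: vy => l'1 c' o'.
case: eqP => [-> //|ln]; have {l1 ln}-> : l = 0 by lia.
by case: s' c' o' => [|[[]|? ?] [|b r]].
Qed.

Lemma ungraftK t : is_internal t -> valid t -> t != cherry ->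
  [/\ valid (ungraft t).1, valid (ungraft t).2
    & graft (ungraft t).1 (ungraft t).2 = t].
Proof.
case: t => // l s _ /= /and3P[l1 c o] ncherry.
case: s c o ncherry => [|a [|b [|d r]]] // c; rewrite [all _ _]/=.
  case: a c => [[]|la sa] c; case: b c => [[]|lb sb] c;
    rewrite ?all_ones_Node /= ?andbT.
  - by case: l l1 => [|[]].
  - by case/and3P=> /eqP -> -> ->; rewrite l1.
  - by case/and3P=> /eqP -> -> ->; rewrite l1.
  - by case/andP=> /and3P[/eqP -> -> ->] /and3P[/eqP -> -> ->]; rewrite l1.
case/and3P=> oa ob od; move: c; rewrite children_ok_insert // => /andP[].
case: b ob => // lb sb; rewrite all_ones_Node => /and3P[/eqP -> cb ob] _ c.
case: a oa c => [[]|la sa] oa c _ /=;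
  by rewrite l1 c cb ob ?oa; case/andP: od => -> ->.
Qed.

Lemma graft_angles x y : valid x -> valid y ->
  angles (graft x y) = (angles x + angles y).+1.
Proof.
case: x => [[]|l s]; case: y => [[]|l' s'] //= vx vy;
  rewrite ?(angles_leaf, anglesE, big_cons, big_nil) //=; try lia.
case/and3P: vx => l1 c o; case/and3P: vy => l'1 c' o'; case: eqP => _.
  by rewrite ?(angles_leaf, anglesE, big_cons, big_nil) /=; lia.
case: s' c' o' => // a r _ _.
by case: r => *; rewrite ?(angles_leaf, anglesE, big_cons, big_nil) /=; lia.
Qed.

Lemma graft_nodes x y : valid x -> valid y ->
  nodes (graft x y) = (nodes x + nodes y).+1.
Proof.
case: x => [[]|l s]; case: y => [[]|l' s'] //= vx vy;
  rewrite ?(nodes_leaf, nodesE, big_cons, big_nil) //=; try lia.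
case/and3P: vx => l1 c o; case/and3P: vy => l'1 c' o'; case: eqP => l_1.
  by rewrite ?(nodes_leaf, nodesE, big_cons, big_nil) /=; lia.
case: s' c' o' => // a r _ _.
by rewrite ?(nodes_leaf, nodesE, big_cons, big_nil) /=; lia.
Qed.

Lemma angles_cherry : angles cherry = 1.
Proof. by rewrite anglesE !big_cons big_nil angles_leaf. Qed.

Lemma nodes_cherry : nodes cherry = 0.
Proof. by rewrite nodesE !big_cons big_nil nodes_leaf. Qed.

(** * Forests *)

Lemma has_card_leaf_head (P : pred (seq ptree)) a b :
    ~~ P [::] -> has_card (fun f => P (leaf :: f)) a ->
    has_card (fun f => is_internal (head leaf f) && P f) b ->
  has_card P (a + b).
Proof.
move=> P0 Pa Pb.
apply: (eq_has_card (has_cardU _ (has_card_headed leaf Pa) Pb)).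
  by case=> [|[[]|l s] f].
by case=> [|[[]|l s] f] //=; rewrite ?orbF // (negbTE P0).
Qed.

(** The pairs in front of a forest whose grafting leads to a forest in [P]. *)
Definition grafted (P : pred (seq ptree)) : pred (seq ptree) :=
  fun f => if f is [:: x, y & f']
           then [&& valid x, valid y & P (graft x y :: f')] else false.

(** The equation F = 1 + x + x y F^2 on nonempty forests, by the shape of the
first tree: leaf, cherry, or grafted. *)
Lemma has_card_forest (P : pred (seq ptree)) a b c :
    ~~ P [::] -> (forall t f, P (t :: f) -> valid t) ->
    has_card (fun f => P (leaf :: f)) a ->
    has_card (fun f => P (cherry :: f)) b -> has_card (grafted P) c ->
  has_card P (a + (b + c)).
Proof.
move=> P0 Pvalid Pa Pb Pc; apply: has_card_leaf_head Pa _ => //.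
have {}Pc : has_card
    (fun f => [&& is_internal (head leaf f), head leaf f != cherry & P f]) c.
  apply: (has_card_bij
    (f := fun f => if f is [:: x, y & f'] then graft x y :: f' else [::])
    (g := fun f => if f is t :: f'
                   then [:: (ungraft t).1, (ungraft t).2 & f'] else [::])) Pc.
    case=> [|x [|y f]] // /and3P[vx vy ->].
    by have [/= -> _ ->] := graft_valid vx vy; rewrite graftK.
  case=> [|t f] // /and3P[it nt Pt].
  by have [vx vy gt] := ungraftK it (Pvalid _ _ Pt) nt; rewrite /= vx vy gt.
apply: (eq_has_card (has_cardU _ (has_card_headed cherry Pb) Pc)).
  by case=> [|t f] //= /andP[/eqP -> _]; rewrite eqxx.
case=> [|t f] /=; first exact/esym/negbTE.
by case: eqP => [->|_] //=; rewrite ?orbF.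
Qed.

Definition forest h u (Q : pred nat) : pred (seq ptree) :=
  fun f => [&& size f == h, all valid f, \sum_(t <- f) nodes t == u
             & Q (\sum_(t <- f) angles t)].

(** [h] trees of node degree [u] in all correspond to [h] binary trees with [u]
inner nodes, and hence [u + h] leaves, in which a subset of the leaves is
marked: each inner node and each marked leaf brings one angle. *)
Lemma has_card_forest_nodes h u Q :
  has_card (forest h u Q)
    (ballot u h * subset_count (u + h) (fun d => Q (u + d))).
Proof.
have leafE h' u' Q' f : forest h'.+1 u' Q' (leaf :: f) = forest h' u' Q' f.
  by rewrite /forest !big_cons nodes_leaf angles_leaf.
have cherryE h' u' (Q' : pred nat) f :
    forest h'.+1 u' Q' (cherry :: f) = forest h' u' (fun d => Q' d.+1) f.
  by rewrite /forest !big_cons nodes_cherry angles_cherry.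
have validP h' u' Q' t f : forest h' u' Q' (t :: f) -> valid t.
  by case/and4P=> _ /andP[].
elim: u h Q => [|u IHu] h Q.
  rewrite mul1n add0n; elim: h Q => [|h IHh] Q.
    rewrite -[subset_count 0 _]/(nat_of_bool (Q 0)); case Q0 : (Q 0).
      apply: (eq_has_card (has_card1 [::])) => -[|t f] //.
      by rewrite /forest !big_nil /= Q0.
    by apply: has_card0 => -[|t f] //; rewrite /forest !big_nil.
  rewrite subset_countS -[X in _ + X]addn0.
  apply: has_card_forest (@validP _ _ _) _ _ _ => //.
  - exact: (eq_has_card (IHh Q)).
  - by apply: (eq_has_card (IHh (fun d => Q d.+1))) => f; rewrite cherryE.
  apply: has_card0 => -[|x [|y f]] //=; rewrite /forest !big_cons.
  by case vx: (valid x); case vy: (valid y); rewrite //= graft_nodes // !andbF.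
elim: h Q => [|h IHh] Q.
  rewrite ballotS0; apply: has_card0 => -[|t f] //.
  by rewrite /forest !big_nil.
have -> : ballot u.+1 h.+1 * subset_count (u.+1 + h.+1) (fun d => Q (u.+1 + d))
   = ballot u.+1 h * subset_count (u.+1 + h) (fun d => Q (u.+1 + d))
   + (ballot u.+1 h * subset_count (u.+1 + h) (fun d => Q (u.+1 + d).+1)
   + ballot u h.+2 * subset_count (u + h.+2) (fun d => Q (u + d).+1)).
  rewrite ballotSS mulnDl addnA -mulnDr addnS subset_countS.
  congr (_ * (_ + _) + _ * _); last by rewrite !addnS.
  by apply: eq_subset_count => d; rewrite addnS.
apply: has_card_forest (@validP _ _ _) _ _ _ => //.
- by apply: (eq_has_card (IHh Q)) => f; rewrite leafE.
- by apply: (eq_has_card (IHh (fun d => Q d.+1))) => f; rewrite cherryE.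
apply: (eq_has_card (IHu h.+2 (fun d => Q d.+1))) => -[|x [|y f]] //=.
rewrite /forest /= !big_cons !eqSS.
case vx: (valid x); case vy: (valid y); rewrite ?andbF //=.
have [_ -> _] := graft_valid vx vy.
by rewrite graft_nodes // graft_angles // !addSn eqSS !addnA.
Qed.

(** The excluded case is the one in which the bare leaf, which is not in T22,
would be counted. *)
Lemma has_card_T22 u (Q : pred nat) : (0 < u) || ~~ Q 0 ->
  has_card (fun t : T22 => (deg_node t == u) && Q (deg_angle t))
           (ballot u 1 * subset_count u.+1 (fun d => Q (u + d))).
Proof.
move=> uQ; have H : has_card (fun t => forest 1 u Q [:: t])
    (ballot u 1 * subset_count u.+1 (fun d => Q (u + d))).
  apply: has_card_singletons => [w /andP[/eqP] //|].
  by rewrite -[X in subset_count X]addn1; apply: has_card_forest_nodes.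
apply: (eq_has_card (has_card_sub T22 _ H)) => [t|[t tP]].
  rewrite /forest /= !big_seq1 is_T22E.
  case: t => [[]|l s]; last by case/andP=> /andP[].
  rewrite nodes_leaf angles_leaf => /and3P[_ /eqP u0 Q0].
  by move: uQ; rewrite -u0 Q0.
rewrite /forest /= !big_seq1.
by have /andP[_ ->] : is_internal t && valid t by rewrite -is_T22E.
Qed.

Definition proper_forest h n : pred (seq ptree) :=
  fun f => [&& size f == h, all is_T22 f & \sum_(t <- f) angles t == n].

(** The coefficient of x^n in (2 x M)^h, where M is the series of colored
Motzkin paths; a path from height h - 1 to 0 contributes M^h x^(h - 1). *)
Definition proper_count n h :=
  match n, h with
  | 0, _ => h == 0 : nat
  | _.+1, 0 => 0
  | n'.+1, h'.+1 => 2 ^ h * motzkin n' h'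
  end.

(** The equation B = 2 x + 2 x B + x B^2 for B = 2 x M: after division by
[2 ^ h.+1], this is the recurrence of Motzkin paths on the first step. *)
Lemma proper_countS n h : proper_count n.+1 h.+1 =
  2 * proper_count n h + 2 * proper_count n h.+1 + proper_count n h.+2.
Proof.
case: n => [|n]; first by case: h => [|h] //=; rewrite muln0.
by case: h => [|h]; rewrite /= ?expnS; nia.
Qed.

Lemma angles_gt0 t : is_T22 t -> 0 < angles t.
Proof.
case: t => // l s; rewrite is_T22E => /and3P[_ _ /andP[]].
by rewrite /children_ok anglesE; case: s => [|a [|b s]].
Qed.

(** The first tree is a cherry or a grafted pair. The cherry and the pair of
two leaves give the term 2 x of B, the pairs with one leaf give 2 x B, and the
pairs without leaf give x B^2. *)
Lemma has_card_proper_forest h n :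
  has_card (proper_forest h n) (proper_count n h).
Proof.
elim: n h => [|n IHn] [|h].
- apply: (eq_has_card (has_card1 [::])) => -[|t f] //=.
  by rewrite /proper_forest !big_nil.
- apply: has_card0 => -[|t f] //; rewrite /proper_forest big_cons addn_eq0 /=.
  case Tt: (is_T22 t); rewrite ?andbF //=.
  by case: (angles t) (angles_gt0 Tt) => // a _; rewrite !andbF.
- by apply: has_card0 => -[|t f] //=; rewrite /proper_forest !big_nil.
have -> : proper_count n.+1 h.+1 = 0 + (proper_count n h
    + ((proper_count n h + proper_count n h.+1)
    + (proper_count n h.+1 + proper_count n h.+2))).
  by rewrite proper_countS; lia.
apply: has_card_forest => //.
- by move=> t f /and3P[_ /andP[+ _] _]; rewrite is_T22E => /andP[].
- by apply: has_card0 => f; rewrite /proper_forest /= andbF.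
- apply: (eq_has_card (IHn h)) => f.
  by rewrite /proper_forest /= big_cons angles_cherry.
have graftE x y f : grafted (proper_forest h.+1 n.+1) [:: x, y & f] =
    [&& valid x, valid y, size f == h, all is_T22 f
      & angles x + angles y + \sum_(t <- f) angles t == n].
  rewrite /grafted /proper_forest /= big_cons.
  case vx: (valid x); case vy: (valid y) => //=.
  have [i v _] := graft_valid vx vy.
  by rewrite is_T22E i v graft_angles // addSn eqSS.
apply: has_card_leaf_head => //.
  apply: has_card_leaf_head => //.
    apply: (eq_has_card (IHn h)) => f.
    by rewrite graftE /= !angles_leaf.
  apply: (eq_has_card (IHn h.+1)) => -[|t f] //.
  rewrite [head _ _]/= graftE /proper_forest /= is_T22E.
  rewrite !big_cons angles_leaf eqSS.
  by case: is_internal; rewrite ?andbF //=; case: valid; rewrite ?andbF.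
(* In the remaining pairs x, y, the tree x is not a leaf. Those in which y is a
   leaf are counted by dropping y. *)
set S := (S in has_card S _).
have SE x y f : S [:: x, y & f] =
    [&& is_T22 x, valid y, size f == h, all is_T22 f
      & angles x + angles y + \sum_(t <- f) angles t == n].
  by rewrite /S graftE /= is_T22E -andbA.
have S1 x : S [:: x] = false by rewrite /S andbF.
apply: (eq_has_card (P := predU
    (fun f => if f is [:: x, y & f'] then (y == leaf) && S f else false)
    (fun f => if f is [:: x, y & f'] then is_internal y && S f else false))).
  apply: has_cardU.
  - by case=> [|x [|[[]|l s] f]].
  - apply: (has_card_bij
      (f := fun f => if f is t :: f' then [:: t, leaf & f'] else [::])
      (g := fun f => if f is t :: f' then t :: behead f' else [::])) (IHn h.+1).
      case=> [|t f]; rewrite /proper_forest //= big_cons.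
      case/and3P=> sf /andP[Tt Tf] af.
      by rewrite SE ?eqxx Tt Tf angles_leaf addn0 af -eqSS sf.
    case=> [|x [|y f]] // /andP[/eqP ->]; rewrite SE angles_leaf addn0.
    case/and5P=> Tx _ sf Tf af.
    by rewrite /proper_forest /= big_cons eqSS sf Tx Tf af.
  - apply: (eq_has_card (IHn h.+2)) => -[|x [|y f]] //;
      rewrite /proper_forest ?andbF //.
    rewrite SE !big_cons /= !eqSS (is_T22E y) addnA.
    case: is_internal; rewrite ?andbF //=; case: is_T22; rewrite ?andbF //=.
    by case: valid; rewrite ?andbF.
by case=> [|x [|[[]|l s] f]] /=; rewrite ?orbF // ?S1.
Qed.

Lemma has_card_T22_angles n : 0 < n ->
  has_card (fun t : T22 => deg_angle t == n) (2 * #|MPhu n|).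
Proof.
case: n => // n _; rewrite card_MPhu //.
have H : has_card (fun t => proper_forest 1 n.+1 [:: t]) (2 * motzkin n 0).
  apply: has_card_singletons => [w /andP[/eqP] //|].
  by rewrite -[2]expn1; apply: has_card_proper_forest.
apply: (eq_has_card (has_card_sub T22 _ H)) => [t|[t tP]].
  by case/and3P=> _ /andP[].
by rewrite /proper_forest /= big_seq1 tP.
Qed.

(** * Ranks of spans of trees *)

(** The module structure of [B22 k] is that of the free module under another
name; this lemma and the next one provide rewrite rules under that name. *)
Lemma mcoeff_scale (k : comNzRingType) (c : k) (x : B22 k) t :
  mcoeff t (c *: x)%R = (c * mcoeff t x)%R.
Proof. exact: mcoeffZ. Qed.

Lemma mcoeff_sum (k : comNzRingType) N (y : 'I_N -> B22 k) t :
  mcoeff t (\sum_(i < N) y i)%R = (\sum_(i < N) mcoeff t (y i))%R.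
Proof. exact: (raddf_sum (mcoeff t)). Qed.

(** The coordinates of [x] on the monomials of [P] are its coefficients, which
gives both existence and uniqueness. *)
Lemma has_rank_monomials (k : comNzRingType) (S : B22 k -> Prop)
    (P : pred T22) r :
    has_card P r -> (forall t, P t -> S (mkmalgU t 1%R)) ->
    (forall x t, S x -> t \in msupp x -> P t) ->
  has_rank S r.
Proof.
case=> s [us sP <-] SU SP.
have mc (c : 'rV[k]_(size s)) t :
    (mcoeff t (\sum_(i < size s)
                 c 0 i *: (mkmalgU (tnth (in_tuple s) i) 1 : B22 k))
     = \sum_(i < size s) (tnth (in_tuple s) i == t)%:R * c 0 i)%R.
  rewrite mcoeff_sum; apply: eq_bigr => i _.
  by rewrite mcoeff_scale mcoeffU mulrC.
exists (fun i => mkmalgU (tnth (in_tuple s) i) 1%R); split=> [i|x Sx].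
  by apply: SU; have := mem_tnth i (in_tuple s); rewrite sP.
have mci (c : 'rV[k]_(size s)) i : mcoeff (tnth (in_tuple s) i)
    (\sum_(i < size s)
       c 0 i *: (mkmalgU (tnth (in_tuple s) i) 1 : B22 k))%R = c 0%R i.
  rewrite mc (bigD1 i) //= eqxx mul1r big1 ?addr0 // => j ji.
  rewrite (_ : (_ == _) = false) ?mul0r //; apply: contraNF ji.
  by rewrite (inj_eq (tuple_uniqP (in_tuple s) us)).
exists (\row_i mcoeff (tnth (in_tuple s) i) x)%R; split=> [|c ->]; last first.
  by apply/rowP => i; rewrite mxE mci.
apply/malgP => t; rewrite mc.
have [st|st] := boolP (t \in s); last first.
  rewrite mcoeff_outdom; last by apply: contra st => /(SP _ _ Sx); rewrite sP.
  rewrite big1 // => i _; case: eqP => [it|_]; last by rewrite mul0r.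
  by have := mem_tnth i (in_tuple s); rewrite it (negbTE st).
have [i ti] : exists i, t = tnth (in_tuple s) i by apply/tnthP.
by rewrite -mc {}ti mci mxE.
Qed.

Lemma msupp_sum (k : comNzRingType) N (y : 'I_N -> B22 k) t :
  t \in msupp (\sum_(i < N) y i)%R -> exists i, t \in msupp (y i).
Proof.
rewrite -mcoeff_neq0 mcoeff_sum => nz; apply/existsP; apply: contraNT nz.
rewrite negb_exists => /forallP y0; rewrite big1 // => i _.
exact: mcoeff_outdom.
Qed.

Lemma B22_homU (k : comNzRingType) (t : T22) :
  B22_hom (deg_angle t) (deg_node t) (mkmalgU t 1%R : B22 k).
Proof. by move=> u; rewrite msuppU oner_eq0 in_fset1 => /eqP ->. Qed.

Lemma internal_sum_single (V : zmodType) (B : nat -> V -> Prop) i x :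
  (forall j, B j 0%R) -> B i x -> internal_sum B x.
Proof.
move=> B0 Bx; exists i.+1, (fun j => if j == ord_max then x else 0%R); split.
  by move=> j; case: eqP => [->|_].
by rewrite -big_mkcond big_pred1_eq.
Qed.

Lemma has_rank_hom (k : comNzRingType) n m r :
    has_card (fun t : T22 => (deg_angle t == n) && (deg_node t == m)) r ->
  has_rank (B22_hom (k := k) n m) r.
Proof.
move/has_rank_monomials; apply=> [t /andP[/eqP <- /eqP <-]|x t Sx /Sx[-> ->]].
  exact: B22_homU.
by rewrite !eqxx.
Qed.

Lemma B22_hom0 (k : comNzRingType) n m : B22_hom n m (0%R : B22 k).
Proof. by move=> t; rewrite msupp0. Qed.

Lemma has_rank_angle (k : comNzRingType) n r :
    has_card (fun t : T22 => deg_angle t == n) r ->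
  has_rank (B22_angle (k := k) n) r.
Proof.
move/has_rank_monomials; apply=> [t /eqP <-|x t].
  by apply: internal_sum_single (@B22_homU k t) => j; apply: B22_hom0.
by case=> N [y [By ->]] /msupp_sum[i /By[-> _]].
Qed.

Lemma has_rank_node (k : comNzRingType) m r :
    has_card (fun t : T22 => (0 < deg_angle t) && (deg_node t == m)) r ->
  has_rank (B22_node (k := k) m) r.
Proof.
move/has_rank_monomials; apply=> [t /andP[a0 /eqP <-]|x t].
  apply: (internal_sum_single (i := (deg_angle t).-1)) => [j|].
    exact: B22_hom0.
  by rewrite prednK //; apply: B22_homU.
by case=> N [y [By ->]] /msupp_sum[i /By[-> ->]]; rewrite eqxx.
Qed.

(** * The dimensions *)

(* In the last clause, m = 0 has to be excluded: the component of node degree 0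
   has rank 1 (see T22_deg_node0), whereas 2 ^ 1 * catalan 0 = 2. *)
Theorem proposition3p7 (k : comNzRingType) (n m : nat) (hn : (1 <= n)%N) :
  [/\ has_rank (B22_hom (k := k) n m) #|RP n m| /\
      #|RP n m| = (catalan m * binz m.+1 (n%:Z - m%:Z)%R)%N,
      has_rank (B22_angle (k := k) n) (2 * #|MPhu n|)%N
    & (1 <= m)%N -> has_rank (B22_node (k := k) m) (2 ^ m.+1 * catalan m)%N].
Proof.
have cardRP : #|RP n m| = catalan m * subset_count m.+1 (fun d => m + d == n).
  have [mn|nm] := leqP m n.
    rewrite card_RP // ballot_catalan -subset_count1; congr (_ * _).
    by apply: eq_subset_count => d /=; lia.
  rewrite (@eq_subset_count _ _ xpred0) => [|d]; last by lia.
  rewrite subset_count0 muln0; apply/eqP; rewrite cards_eq0.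
  apply/eqP/setP => w.
  by rewrite !inE /is_RP; apply/negP => /and5P[_ _ _ /eqP + _]; lia.
have binzE :
    binz m.+1 (n%:Z - m%:Z)%R = subset_count m.+1 (fun d => m + d == n).
  have [mn|nm] := leqP m n.
    rewrite subzn // [binz _ _]/= -subset_count1.
    by apply: eq_subset_count => d /=; lia.
  rewrite (@eq_subset_count _ _ xpred0) => [|d]; last by lia.
  rewrite subset_count0.
  by have -> : (n%:Z - m%:Z)%R = Negz (m - n).-1 by lia.
split; [split|..].
- apply: has_rank_hom; rewrite cardRP -ballot_catalan.
  apply: (eq_has_card (has_card_T22 (u := m) (Q := fun a => a == n) _)) => [|t].
    by lia.
  exact: andbC.
- by rewrite cardRP binzE.
- exact/has_rank_angle/has_card_T22_angles.
- move=> m_gt0; apply: has_rank_node.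
  rewrite mulnC -ballot_catalan -subset_countT.
  have mT : (0 < m) || ~~ predT 0 by rewrite m_gt0.
  apply: (eq_has_card (has_card_T22 mT)) => t.
  by have -> : 0 < deg_angle t := angles_gt0 (valP t); rewrite andbC.
Qed.
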